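(* Let $G$ be a threshold graph on $n$ vertices given by a creation sequence. Then all independent sets of $G$ can be counted in time $O(n)$ and enumerated in time $O(n\cdot 2^{n-1})$.
   Context: A graph $G=(V,E)$ is a threshold graph if it can be built from a single vertex by repeatedly adding an isolated vertex or a dominating vertex. A creation sequence for $G$ with $|V|=n$ is a binary string $t_1\ldots t_n$ with $t_1=1$, together with a bijection $v:\{1,\ldots,n\}\to V$, such that for $i\ge2$: $t_i=1$ if $v(i)$ is adjacent to all of $v(1),\ldots,v(i-1)$, and $t_i=0$ if $v(i)$ is adjacent to none of them. Independent sets here are non-empty vertex subsets with no edge between any two of their vertices. *)

(* Defs.v *)
From mathcomp Require Import all_boot.

Set Implicit Arguments.
Unset Strict Implicit.
Unset Printing Implicit Defensive.

Definition simple_graph (T : finType) (e : rel T) : Prop :=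
  symmetric e /\ irreflexive e.

(* [built_up e A]: the subgraph induced on A can be built from a single vertex
   by repeatedly adding an isolated or a dominating vertex. *)
Inductive built_up (T : finType) (e : rel T) : {set T} -> Prop :=
| built_single x : built_up e [set x]
| built_isolated A x :
    built_up e A -> x \notin A -> {in A, forall y, ~~ e x y} ->
    built_up e (x |: A)
| built_dominating A x :
    built_up e A -> x \notin A -> {in A, forall y, e x y} ->
    built_up e (x |: A).

Definition threshold_graph (T : finType) (e : rel T) : Prop :=
  built_up e [set: T].

(* Positions 1, ..., n are represented by 0, ..., n - 1, and the symbols 1 and
   0 of the binary string by true and false. *)
Definition creation_sequence (T : finType) (e : rel T) (n : nat)
    (t : n.-tuple bool) (v : 'I_n -> T) : Prop :=
  [/\ bijective v,
      forall i : 'I_n, i = 0 :> nat -> tnth t i = true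
    & forall i : 'I_n, 0 < i ->
        if tnth t i then forall j : 'I_n, j < i -> e (v i) (v j)
        else forall j : 'I_n, j < i -> ~~ e (v i) (v j)].

Definition independent_sets (T : finType) (e : rel T) : {set {set T}} :=
  [set S : {set T} | (S != set0)
                     && [forall x in S, forall y in S, ~~ e x y]].

(* Random access machines with the uniform cost criterion: every instruction
   takes one time unit. The machine has registers (directly addressed) and a
   memory (indirectly addressed), both holding natural numbers, and a
   write-only output tape. *)

Inductive instr : Type :=
| IConst of nat & nat
| IAdd of nat & nat & nat
| ISub of nat & nat & nat
| ILoad of nat & nat
| IStore of nat & nat
| IWrite of nat
| IJump of nat
| IJzero of nat & nat.

Definition program := seq instr.

Record state := State {
  pc : nat;
  regs : nat -> nat;
  mem : nat -> nat;
  output : seq nat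
}.

Definition upd (f : nat -> nat) (a x : nat) : nat -> nat :=
  fun b => if b == a then x else f b.

Definition exec (i : instr) (s : state) : state :=
  let: State p R M o := s in
  match i with
  | IConst r k => State p.+1 (upd R r k) M o
  | IAdd r a b => State p.+1 (upd R r (R a + R b)) M o
  | ISub r a b => State p.+1 (upd R r (R a - R b)) M o
  | ILoad r a => State p.+1 (upd R r (M (R a))) M o
  | IStore a r => State p.+1 R (upd M (R a) (R r)) o
  | IWrite r => State p.+1 R M (rcons o (R r))
  | IJump l => State l R M o
  | IJzero r l => State (if R r == 0 then l else p.+1) R M o
  end.

(* The machine halts when the program counter leaves the program; a halted
   state is a fixed point of [step]. *)
Definition halted (P : program) (s : state) : bool := size P <= pc s.

Definition step (P : program) (s : state) : state :=
  if onth P (pc s) is Some i then exec i s else s.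

Definition init (input : seq nat) : state :=
  State 0 (fun=> 0) (nth 0 input) [::].

Definition outputs_within (P : program) (input : seq nat) (time : nat)
    (out : seq nat) : Prop :=
  exists k : nat,
    [/\ k <= time,
        halted P (iter k (step P) (init input))
      & output (iter k (step P) (init input)) = out].

(* Vertices are numbered from 1; the number 0 is kept as an end mark. *)
Definition vertex_name (T : finType) (x : T) : nat := (enum_rank x).+1.

Definition encode_creation (T : finType) (n : nat) (t : n.-tuple bool)
    (v : 'I_n -> T) : seq nat :=
  n :: [seq nat_of_bool b | b <- t] ++ [seq vertex_name (v i) | i <- enum 'I_n].

Definition encode_sets (T : finType) (L : seq (seq T)) : seq nat :=
  flatten [seq rcons [seq vertex_name x | x <- s] 0 | s <- L].

(* L lists every independent set exactly once, each one as a list of its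
   vertices without repetition. *)
Definition lists_independent_sets (T : finType) (e : rel T)
    (L : seq (seq T)) : Prop :=
  [/\ all uniq L,
      uniq [seq [set x in s] | s : seq T <- L]
    & [seq [set x in s] | s : seq T <- L] =i independent_sets e].

(* Main.v *)
(** A set of vertices is independent iff each of its elements other than the
first created one has symbol 0. Hence the number of independent sets with first
element [i] is [2 ^ z], where [z] counts the symbols 0 after position [i], and a
single pass from the last vertex down to the first adds these powers of two. For
the enumeration, a binary counter in memory runs through the [2 ^ n] subsets;
incrementing it, testing the criterion and printing the set each take time
[O(n)], and [n * 2 ^ n] is twice [n * 2 ^ (n - 1)]. *)

Require Import Defs.
From mathcomp Require Import all_boot.
From mathcomp Require Import zify.

Set Implicit Arguments.
Unset Strict Implicit.
Unset Printing Implicit Defensive.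

(** * Time-bounded runs and lists stored in memory *)

Definition reaches (P : program) (k : nat) (s : state) (Q : state -> Prop) :=
  exists2 j, j <= k & Q (iter j (step P) s).

Lemma reaches_now P k s (Q : state -> Prop) : Q s -> reaches P k s Q.
Proof. by exists 0. Qed.

Lemma reaches_step P k s Q : reaches P k (step P s) Q -> reaches P k.+1 s Q.
Proof. by case=> j lejk Qj; exists j.+1; rewrite // iterSr. Qed.

Lemma reaches_leq P k k' s Q : k <= k' -> reaches P k s Q -> reaches P k' s Q.
Proof. by move=> lek [j lej Qj]; exists j => //; apply: leq_trans lek. Qed.

Definition halts_with (P : program) (out : seq nat) (s : state) : Prop :=
  halted P s /\ output s = out.

Lemma outputs_withinP P input k out :
  reaches P k (init input) (halts_with P out) -> outputs_within P input k out.
Proof. by case=> j lejk [hj oj]; exists j. Qed.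

(* [s] occupies the addresses [a + 1, ..., a + size s] in decreasing order, so
   that a loop whose index register runs from [size s] down to [0] reads [s]
   from its head. *)
Fixpoint stored (M : nat -> nat) (a : nat) (s : seq nat) : Prop :=
  if s is x :: s' then M (a + size s) = x /\ stored M a s' else True.

Lemma eq_stored M M' a s :
  (forall x, a < x <= a + size s -> M' x = M x) ->
  stored M a s -> stored M' a s.
Proof.
elim: s => //= x s IHs eqM [Mx Ms]; split; first by rewrite eqM //; lia.
by apply: IHs Ms => y le_y; apply: eqM; lia.
Qed.

Lemma stored_rev M a s :
  (forall i, i < size s -> M (a + i.+1) = nth 0 s i) -> stored M a (rev s).
Proof.
elim/last_ind: s => // s x IHs Ms; rewrite rev_rcons /= size_rev.
rewrite size_rcons in Ms; split; first by rewrite Ms // nth_rcons ltnn eqxx.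
by apply: IHs => i lti; rewrite Ms ?nth_rcons ?lti //; lia.
Qed.

(** * The counting program *)

Definition count_program : program :=
  [:: IConst 0 1;
      ILoad 1 2;
      IConst 3 1;
      IJzero 1 11;
      IAdd 4 4 3;
      ILoad 2 1;
      IJzero 2 8;
      IJump 9;
      IAdd 3 3 3;
      ISub 1 1 0;
      IJump 3;
      IWrite 4].

(* The head of [ts] is the symbol of the last created vertex. *)
Fixpoint independent_count (ts : bitseq) : nat :=
  if ts is t :: ts' then
    (independent_count ts').+1 + (if t then 0 else independent_count ts')
  else 0.

Lemma updE f a x b : upd f a x b = if b == a then x else f b.
Proof. by []. Qed.

(* Executes one instruction, simplifying register and memory reads with the
   rewrite rules [E]; executing several at once would leave nested tests on the
   program counter. *)
Ltac execute E := apply: reaches_step; rewrite /step /= ?updE /= ?E /=.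

(* Registers 4 and 3 hold the number of independent sets found so far and the
   number of subsets of the symbol-0 vertices already passed. *)
Lemma count_loop M o c ts R :
  R 0 = 1 -> R 1 = size ts -> stored M 0 (map nat_of_bool ts) ->
  c = R 4 + R 3 * independent_count ts ->
  reaches count_program (7 * size ts).+2 (State 3 R M o)
    (halts_with count_program (rcons o c)).
Proof.
elim: ts R => [|t ts IHts] R R0 /= R1.
  move=> _ ->; do 2 apply: reaches_step; rewrite /step /= R1 /=.
  by apply: reaches_now; split; rewrite //= muln0 addn0.
rewrite size_map add0n => -[Mt Mts] Ec; rewrite mulnS !addSn add0n.
(* Both branches take seven instructions: jumping over the doubling costs as much as the
   doubling. *)
by case: t Mt Ec => Mt Ec; do 7 execute (R0, R1, Mt);
  apply: IHts; rewrite // !updE /= ?Ec; lia.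
Qed.

Lemma count_programP M ts :
  M 0 = size ts -> stored M 0 (map nat_of_bool ts) ->
  reaches count_program (7 * size ts + 5) (State 0 (fun=> 0) M [::])
    (halts_with count_program [:: independent_count ts]).
Proof.
move=> M0 Mts; rewrite addnC !addSn add0n; do 3 execute M0.
by apply: (@count_loop M [::]); rewrite ?updE //= mul1n.
Qed.

(** * The three inner loops of the enumeration program *)

Definition enum_program : program :=
  [:: IConst 0 1;
      ILoad 1 2;
      IAdd 2 1 1;
      (* 3: increment the binary counter *)
      IAdd 3 1 7;
      IJzero 3 35;
      IAdd 4 3 2;
      ILoad 5 4;
      IJzero 5 11;
      IStore 4 7;
      ISub 3 3 0;
      IJump 4;
      IStore 4 0;
      (* 12: test whether the selected set is independent *)
      IAdd 3 1 7;
      IConst 6 0;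
      IJzero 3 23;
      IAdd 4 3 2;
      ILoad 5 4;
      IJzero 5 21;
      IJzero 6 20;
      IJump 3;
      ILoad 6 3;
      ISub 3 3 0;
      IJump 14;
      (* 23: print the selected set *)
      IAdd 3 1 7;
      IJzero 3 33;
      IAdd 4 3 2;
      ILoad 5 4;
      IJzero 5 31;
      IAdd 4 3 1;
      ILoad 5 4;
      IWrite 5;
      ISub 3 3 0;
      IJump 24;
      IWrite 7;
      IJump 3].

(** The symbols fill cells [1] to [n], the names the next [n] and the counter digits the [n] after
    those, so registers 1 and 2 are the offsets of the last two blocks. Register 7 is never written
    and supplies zero. *)
Definition enum_consts (n : nat) (R : nat -> nat) : Prop :=
  [/\ R 0 = 1, R 1 = n, R 2 = n + n & R 7 = 0].

Fixpoint incr (bs : bitseq) : bitseq :=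
  if bs is b :: bs' then if b then false :: incr bs' else true :: bs'
  else [::].

Lemma size_incr bs : size (incr bs) = size bs.
Proof. by elim: bs => [|[] bs IHbs] //=; rewrite IHbs. Qed.

(* Seen from the last vertex down, a selected dominating vertex must be the
   final selected one; [f] tells that such a vertex has been met. *)
Fixpoint selects_independent (f : bool) (bs ts : bitseq) : bool :=
  match bs, ts with
  | b :: bs', t :: ts' =>
    if b then ~~ f && selects_independent t bs' ts'
    else selects_independent f bs' ts'
  | _, _ => true
  end.

(** The rest of the run is a premise, so that loops compose by application. Overflow leaves for the
    halting address 35; otherwise only digits change, which preserves symbols and names. *)
Lemma incr_loop n k Q o bs R M :
  enum_consts n R -> R 3 = size bs ->
  stored M (n + n) (map nat_of_bool bs) ->
  (if all id bs then
     forall R' M', reaches enum_program k (State 35 R' M' o) Q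
   else
     forall R' M', enum_consts n R' ->
       stored M' (n + n) (map nat_of_bool (incr bs)) ->
       (forall a, ~~ (n + n < a <= n + n + size bs) -> M' a = M a) ->
       reaches enum_program k (State 12 R' M' o) Q) ->
  reaches enum_program (k + 7 * size bs + 5) (State 4 R M o) Q.
Proof.
elim: bs R M => [|b bs IHbs] R M [R0 R1 R2 R7] /= R3.
  move=> _ cont; apply: (@reaches_leq _ k.+1); first lia.
  by execute R3.
rewrite size_map [n + n + _]addnC => -[Mb Mbs].
case: b Mb => Mb /=.
  move=> cont; apply: (@reaches_leq _ (k + 7 * size bs + 5).+4.+3); first lia.
  do 7 execute (R0, R2, R3, R7, Mb).
  apply: IHbs => //=; first by rewrite !updE /= subn1.
    apply: eq_stored Mbs => x; rewrite size_map => le_x.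
    by rewrite updE ifF //; lia.
  case: (all id bs) cont => // cont R' M' cR' M'bs eqM'; apply: cont => //.
  (* The digit just cleared lies above the range of the recursive call, so it stays zero. *)
  - split=> //; rewrite size_map size_incr eqM'; last lia.
    by rewrite updE ifT //; lia.
  - move=> a Na; rewrite eqM'; last lia.
    by rewrite updE ifF //; lia.
move=> cont; apply: (@reaches_leq _ k.+4.+1); first lia.
do 5 execute (R0, R2, R3, Mb).
apply: cont => //=.
- split; first by rewrite size_map updE ifT //; lia.
  apply: eq_stored Mbs => x; rewrite size_map => le_x.
  by rewrite updE ifF //; lia.
- by move=> a Na; rewrite updE ifF //; lia.
Qed.

Lemma check_loop n k Q o M bs ts (f : bool) R :
  enum_consts n R -> R 3 = size bs -> R 6 = f -> size ts = size bs ->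
  stored M (n + n) (map nat_of_bool bs) -> stored M 0 (map nat_of_bool ts) ->
  (forall R', enum_consts n R' ->
     reaches enum_program k
       (State (if selects_independent f bs ts then 23 else 3) R' M o) Q) ->
  reaches enum_program (k + 8 * size bs + 1) (State 14 R M o) Q.
Proof.
move=> cR R3 R6 szt Mbs Mts cont.
elim: bs ts f R cR R3 R6 szt Mbs Mts cont =>
  [|b bs IHbs] [|t ts] // f R cR /= R3 R6 szt.
  move=> _ _ cont; apply: (@reaches_leq _ k.+1); first lia.
  by execute R3; apply: cont.
case: szt => szt; rewrite !size_map add0n szt [n + n + _]addnC => -[Mb Mbs] [Mt Mts] cont.
have [R0 R1 R2 R7] := cR.
case: b Mb cont => Mb cont; last first.
  apply: (@reaches_leq _ (k + 8 * size bs + 1).+4.+2); first lia.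
  do 6 execute (R0, R2, R3, Mb).
  by apply: (IHbs ts f) => //=; rewrite !updE /= subn1.
(* With the flag set, a further selected vertex ends the test at once and the next round starts. *)
case: f R6 cont => R6 cont.
  apply: (@reaches_leq _ k.+4.+2); first lia.
  by do 6 execute (R2, R3, R6, Mb); apply: cont.
apply: (@reaches_leq _ (k + 8 * size bs + 1).+4.+4); first lia.
do 8 execute (R0, R2, R3, R6, Mb).
by apply: (IHbs ts t) => //=; rewrite !updE /= ?subn1.
Qed.

Lemma print_loop n k Q M bs ns o R :
  enum_consts n R -> R 3 = size bs -> size ns = size bs ->
  stored M (n + n) (map nat_of_bool bs) -> stored M n ns ->
  (forall R', enum_consts n R' ->
     reaches enum_program k (State 3 R' M (o ++ rcons (mask bs ns) 0)) Q) ->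
  reaches enum_program (k + 9 * size bs + 3) (State 24 R M o) Q.
Proof.
move=> cR R3 szn Mbs Mns cont.
elim: bs ns o R cR R3 szn Mbs Mns cont =>
  [|b bs IHbs] [|x ns] // o R cR /= R3 szn.
  move=> _ _ cont; apply: (@reaches_leq _ k.+3); first lia.
  have [R0 R1 R2 R7] := cR.
  by do 3 execute (R3, R7); rewrite -cats1; apply: cont.
case: szn => szn; rewrite !size_map szn.
rewrite [n + n + _]addnC [n + _.+1]addnC => -[Mb Mbs] [Mx Mns] cont.
have [R0 R1 R2 R7] := cR.
case: b Mb cont => Mb cont; last first.
  apply: (@reaches_leq _ (k + 9 * size bs + 3).+4.+2); first lia.
  do 6 execute (R0, R2, R3, Mb).
  by apply: (IHbs ns) => //=; rewrite !updE /= subn1.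
apply: (@reaches_leq _ (k + 9 * size bs + 3).+4.+4.+1); first lia.
do 9 execute (R0, R1, R2, R3, Mb, Mx).
apply: (IHbs ns) => //=; first by rewrite !updE /= subn1.
by move=> R' cR'; rewrite cat_rcons; apply: cont.
Qed.

(** * Binary expansions of counter values *)

(* The [n] low-order binary digits of [k], least significant digit first. *)
Fixpoint bits (n k : nat) : bitseq :=
  if n is n'.+1 then odd k :: bits n' k./2 else [::].

Lemma size_bits n k : size (bits n k) = n.
Proof. by elim: n k => //= n IHn k; rewrite IHn. Qed.

Lemma incr_bits n k : incr (bits n k) = bits n k.+1.
Proof.
elim: n k => //= n IHn k; rewrite uphalf_half.
by case: (odd k); rewrite // IHn add1n.
Qed.

(** The counter overflows exactly after its largest value, which stops the enumeration. *)
Lemma all_bits n k : k < 2 ^ n -> all id (bits n k) = (k.+1 == 2 ^ n).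
Proof.
elim: n k => [|n IHn] k; first by case: k.
rewrite expnS /= => ltk; rewrite IHn; last by lia.
by have := odd_double_half k; case: (odd k) => /= Ek; lia.
Qed.

Lemma bits0 n : bits n 0 = nseq n false.
Proof. by elim: n => //= n ->. Qed.

Lemma bits_inj n : {in [pred k | k < 2 ^ n] &, injective (bits n)}.
Proof.
elim: n => [|n IHn] j k; rewrite !inE; first by case: j k => [|j] [|k].
rewrite expnS /= => ltj ltk [Eodd /IHn Ehalf].
by rewrite -[j]odd_double_half -[k]odd_double_half Eodd Ehalf // inE; lia.
Qed.

Lemma bits_surj bs : exists2 k, k < 2 ^ size bs & bs = bits (size bs) k.
Proof.
elim: bs => [|b bs [k ltk Ebs]]; first by exists 0.
exists (b + k.*2); first by rewrite /= expnS; case: b; lia.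
by rewrite /= oddD odd_double addbF oddb half_bit_double -Ebs.
Qed.

(** * Whole runs of the enumeration program *)

Definition selected_masks T (ts : bitseq) (s : seq T) (j m : nat) :
    seq (seq T) :=
  [seq mask (bits (size s) k) s | k <- iota j m
     & selects_independent false (bits (size s) k) ts].

(** The value [j] has been dealt with and [m] values remain; the extra round is the one that
    overflows and halts. *)
Lemma enum_rounds ts ns out m j o R M :
  let n := size ns in
  size ts = n -> stored M 0 (map nat_of_bool ts) -> stored M n ns ->
  enum_consts n R -> stored M (n + n) (map nat_of_bool (bits n j)) ->
  j + m.+1 = 2 ^ n ->
  out = o ++ flatten [seq rcons s 0 | s <- selected_masks ts ns j.+1 m] ->
  reaches enum_program (m.+1 * (24 * n + 13)) (State 3 R M o)
    (halts_with enum_program out).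
Proof.
move=> n szt; elim: m j o R M => [|m IHm] j o R M Mts Mns cR Mbs Ej Eout.
  have [R0 R1 R2 R7] := cR.
  apply: (@reaches_leq _ (0 + 7 * size (bits n j) + 5).+1).
    by rewrite size_bits; lia.
  execute (R1, R7, addn0).
  apply: incr_loop Mbs _; rewrite ?updE ?size_bits // all_bits; last lia.
  rewrite ifT; last lia.
  by move=> R' M'; apply: reaches_now; split; rewrite //= Eout cats0.
have [R0 R1 R2 R7] := cR.
set K := m.+1 * (24 * n + 13).
(* One round costs [7 * n + 5] to increment, [8 * n + 1] to test and [9 * n + 3] to print, with 1, 2
   and 1 instructions to set up these loops: at most [24 * n + 13]. *)
apply: (@reaches_leq _ (((K + 9 * n + 3).+1 + 8 * n + 1).+2 + 7 * n + 5).+1).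
  by rewrite [m.+2 * _]mulSn /K; lia.
execute (R1, R7, addn0).
rewrite -[X in 7 * X](size_bits n j).
apply: incr_loop Mbs _; rewrite ?updE ?size_bits //.
rewrite all_bits; last lia.
rewrite ifF; last lia.
rewrite incr_bits => {R0 R1 R2 R7} R' M1 [R0 R1 R2 R7] Mbs eqM.
have {}Mts : stored M1 0 (map nat_of_bool ts).
  by apply: eq_stored Mts => x; rewrite size_map szt => le_x; apply: eqM; lia.
have {}Mns : stored M1 n ns.
  by apply: eq_stored Mns => x le_x; apply: eqM; rewrite -/n in le_x; lia.
do 2 execute (R1, R7, addn0).
rewrite -[X in 8 * X](size_bits n j.+1).
apply: (@check_loop n _ _ _ _ _ _ false) (Mbs) (Mts) _; rewrite ?updE ?size_bits //.
move=> R3 cR3; case: ifP => [sel | unsel]; last first.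
  apply: (@reaches_leq _ K); first lia.
  apply: IHm Mts Mns cR3 Mbs _ _; first lia.
  by rewrite Eout /selected_masks /= -/n unsel.
have [R30 R31 R32 R37] := cR3.
execute (R31, R37, addn0).
rewrite -[X in 9 * X](size_bits n j.+1).
apply: print_loop (Mbs) (Mns) _; rewrite ?updE ?size_bits // => R4 cR4.
apply: IHm Mts Mns cR4 Mbs _ _; first lia.
by rewrite Eout /selected_masks /= -/n sel /= catA.
Qed.

(** The counter starts at 0 and is incremented before each test, so the empty set is never
    printed. *)
Lemma enum_programP M ts ns :
  let n := size ns in
  size ts = n -> M 0 = n -> stored M 0 (map nat_of_bool ts) ->
  stored M n ns -> stored M (n + n) (nseq n 0) ->
  reaches enum_program (2 ^ n * (24 * n + 13) + 3) (State 0 (fun=> 0) M [::])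
    (halts_with enum_program
       (flatten [seq rcons s 0 | s <- selected_masks ts ns 1 (2 ^ n).-1])).
Proof.
move=> n szt M0 Mts Mns Mbs; rewrite addnC !addSn add0n.
do 3 execute M0.
have gt0 : 0 < 2 ^ n by rewrite expn_gt0.
rewrite -{1}(prednK gt0).
apply: (@enum_rounds ts ns _ _ 0) => //.
- by rewrite bits0 map_nseq.
- by rewrite add0n prednK.
Qed.

(** Passes from the names that the machine prints to the vertices that independence is about. *)
Lemma selected_masks_map T T' (f : T -> T') ts s j m :
  selected_masks ts (map f s) j m = map (map f) (selected_masks ts s j m).
Proof.
rewrite /selected_masks size_map -map_comp; apply: eq_map => k /=.
by rewrite map_mask.
Qed.

(** Splits counter values by their lowest digit, that is, by whether the last vertex is selected. *)
Lemma count_iota_double (p : pred nat) m :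
  count p (iota 0 m.*2) =
  count (fun k => p k.*2) (iota 0 m) + count (fun k => p k.*2.+1) (iota 0 m).
Proof.
elim: m => // m IHm; rewrite doubleS -[m.*2.+2]addn2 -[m.+1]addn1 !iotaD.
by rewrite !count_cat IHm /= !add0n; lia.
Qed.

(** The empty selection is always accepted, hence the successor; once the flag is set it is the only
    one. *)
Lemma count_selects_independent f ts :
  count (fun k => selects_independent f (bits (size ts) k) ts)
    (iota 0 (2 ^ size ts)) = if f then 1 else (independent_count ts).+1.
Proof.
elim: ts f => [|t ts IHts] f; first by case: f.
rewrite /= expnS mul2n count_iota_double.
under eq_count do rewrite odd_double doubleK.
rewrite IHts.
under eq_count do rewrite /= odd_double uphalf_double.
case: f => /=; first by rewrite count_pred0.
by rewrite IHts; case: t; rewrite ?addn1 ?addn0 //; lia.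
Qed.

(** * Independent sets of a threshold graph *)

Section ThresholdGraph.

Variables (T : finType) (e : rel T).
Hypothesis e_simple : simple_graph e.

Fixpoint creation_list (ts : bitseq) (vs : seq T) : bool :=
  match ts, vs with
  | t :: ts', x :: vs' => all (fun y => e x y == t) vs' && creation_list ts' vs'
  | [::], [::] => true
  | _, _ => false
  end.

Lemma creation_list_size ts vs : creation_list ts vs -> size ts = size vs.
Proof.
by elim: ts vs => [|t ts IHts] [|x vs] //= /andP[_ /IHts ->].
Qed.

Lemma creation_list_rev x0 ts vs :
  size ts = size vs ->
  (forall i j, j < i < size ts ->
     e (nth x0 vs i) (nth x0 vs j) = nth true ts i) ->
  creation_list (rev ts) (rev vs).
Proof.
elim/last_ind: ts vs => [|ts t IHts] vs; case/lastP: vs => [|vs x] //;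
  rewrite ?size_rcons // => -[sz] ets.
rewrite !rev_rcons /= all_rev; apply/andP; split.
  apply/(all_nthP x0) => j ltj; apply/eqP.
  have := ets (size vs) j; rewrite !nth_rcons sz ltj ltnn eqxx.
  by apply; lia.
apply: IHts => // i j lt_ji; have := ets i j; rewrite !nth_rcons -sz.
by rewrite !ifT; [apply; lia | lia | lia | lia].
Qed.

Lemma selects_independentE f bs ts vs :
  creation_list ts vs -> size bs = size ts ->
  selects_independent f bs ts =
  pairwise (fun x y => ~~ e x y) (mask bs vs) && (f ==> ~~ has id bs).
Proof.
elim: bs f ts vs => [|b bs IHbs] f [|t ts] [|x vs] //=; first by rewrite implybT.
case/andP=> ex cl [sz]; case: b => /=; last exact: IHbs.
case: f => /=; first by rewrite andbF.
rewrite (IHbs _ _ _ cl sz) andbC andbT; congr (_ && _).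
have szm : size (mask bs vs) = count id bs.
  by rewrite size_mask // sz (creation_list_size cl).
(* A vertex with symbol 1 is adjacent to all earlier ones, so none of them may be selected; one with
   symbol 0 conflicts with none. *)
case: t ex => ex /=.
  rewrite has_count -szm.
  have : all (fun y => e x y == true) (mask bs vs) by apply: all_mask.
  by case: (mask bs vs) => //= y s /andP[/eqP->].
by apply/esym/all_mask; apply: sub_all ex => y /eqP->.
Qed.

(** [pairwise] sees each pair of positions in one order only; symmetry and irreflexivity of [e] give
    the remaining pairs. *)
Lemma in_independent_sets (s : seq T) :
  ([set x in s] \in independent_sets e) =
  (s != [::]) && pairwise (fun x y => ~~ e x y) s.
Proof.
have [e_sym e_irr] := e_simple.
rewrite pairwise_all2rel => [|x|x y]; [|by rewrite e_irr|by rewrite e_sym].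
rewrite inE; congr (_ && _).
  apply/set0Pn/idP => [[x]|]; first by case: s => //; rewrite inE.
  by case: s => // x s _; exists x; rewrite inE mem_head.
apply/forall_inP/allrelP => [indep x y sx sy | indep x].
  by apply: (forall_inP (indep x _)); rewrite inE.
by rewrite inE => sx; apply/forall_inP => y; rewrite inE; apply: indep.
Qed.

(** A mask can be recovered from the set it selects, so distinct counter values give distinct
    sets. *)
Lemma mem_masks (vs : seq T) (bs : bitseq) :
  uniq vs -> size bs = size vs -> [seq x \in mask bs vs | x <- vs] = bs.
Proof.
elim: vs bs => [|x vs IHvs] [|b bs] //= /andP[xvs uvs] [sz].
have xm : x \notin mask bs vs by apply: contra xvs; apply: mem_mask.
case: b => /=.
  rewrite mem_head; congr (_ :: _); rewrite -[RHS]IHvs //.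
  apply/eq_in_map => y yvs; rewrite inE; case: eqP => // y_x.
  by rewrite -y_x yvs in xvs.
by rewrite (negbTE xm) IHvs.
Qed.

Variables (ts : bitseq) (vs : seq T).
Hypotheses (cl : creation_list ts vs) (uvs : uniq vs).
Hypothesis vsT : forall x, x \in vs.

Let L := selected_masks ts vs 1 (2 ^ size vs).-1.

Lemma selected_masks_independent : lists_independent_sets e L.
Proof.
have szt := creation_list_size cl.
have gt0 : 0 < 2 ^ size vs by rewrite expn_gt0.
have mem_iota1 k : (k \in iota 1 (2 ^ size vs).-1) = (0 < k < 2 ^ size vs).
  by rewrite mem_iota add1n prednK.
split.
- by apply/allP => s /mapP[k _ ->]; apply: mask_uniq.
- rewrite -map_comp map_inj_in_uniq ?filter_uniq ?iota_uniq // => j k.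
  rewrite !mem_filter !mem_iota1 => /and3P[_ _ ltj] /and3P[_ _ ltk] /= Eset.
  apply: (@bits_inj (size vs)) => //.
  rewrite -[LHS](mem_masks uvs) ?size_bits // -[RHS](mem_masks uvs) ?size_bits //.
  by apply: eq_map => x; move/setP/(_ x): Eset; rewrite !inE.
move=> S; apply/mapP/idP => [[s /mapP[k]] | indS].
  rewrite mem_filter mem_iota1 => /and3P[sel gtk ltk] -> ->.
  rewrite in_independent_sets.
  move: sel; rewrite (selects_independentE _ cl) ?size_bits // andbT => ->.
  rewrite andbT -size_eq0 size_mask ?size_bits // -lt0n -has_count.
  (* A positive counter value has a digit 1, for otherwise its digits would be those of 0. *)
  apply: contraTT gtk => /hasPn nobit; rewrite -leqNgt leqn0; apply/eqP.
  apply: (@bits_inj (size vs)); rewrite ?inE //.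
  rewrite bits0 -{2}(size_bits (size vs) k); apply/all_pred1P/allP => b /nobit.
  by case: b.
(* The counter value is read off the characteristic vector of [S]. *)
have [k ltk Ek] := bits_surj [seq x \in S | x <- vs].
rewrite size_map in ltk Ek.
have ES : S = [set x in mask (bits (size vs) k) vs].
  by apply/setP=> x; rewrite -Ek -filter_mask inE mem_filter vsT andbT.
exists (mask (bits (size vs) k) vs) => //; apply/mapP; exists k => //.
move: indS; rewrite {1}ES in_independent_sets => /andP[nz pw].
rewrite mem_filter mem_iota1 ltk (selects_independentE _ cl) ?size_bits // pw.
rewrite /= andbT lt0n; apply: contraNneq nz => ->.
by rewrite bits0 mask_false.
Qed.

Lemma card_independent_sets : #|independent_sets e| = independent_count ts.
Proof.
have [_ uL memL] := selected_masks_independent.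
rewrite -(eq_card memL) (card_uniqP uL) !size_map size_filter.
(* The added one stands for counter value 0, which the list omits. *)
apply: succn_inj; rewrite -(count_selects_independent false).
rewrite (creation_list_size cl) -[in RHS](@prednK (2 ^ _)) ?expn_gt0 //=.
rewrite (selects_independentE _ cl) ?size_bits ?(creation_list_size cl) //.
by rewrite bits0 mask_false.
Qed.

End ThresholdGraph.

(** Gives [0 < n], by which the time bounds absorb their additive constants. *)
Lemma built_up_gt0 (T : finType) (e : rel T) A : built_up e A -> 0 < #|A|.
Proof.
by case=> [x|B x _ _ _|B x _ _ _]; apply/card_gt0P; exists x; rewrite !inE eqxx.
Qed.

(** * The encoded input as initial memory *)

Section Encoding.

Variables (n : nat) (T : finType) (e : rel T).
Variables (t : n.-tuple bool) (v : 'I_n -> T).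
Hypotheses (e_threshold : threshold_graph e) (cardT : #|T| = n).
Hypothesis tv_creation : creation_sequence e t v.

Let ts := rev t.
Let vs := rev [seq v i | i <- enum 'I_n].
Let M := nth 0 (encode_creation t v).

Lemma threshold_graph_gt0 : 0 < n.
Proof. by rewrite -cardT -cardsT; apply: built_up_gt0 e_threshold. Qed.

Lemma vertices_uniq : uniq vs.
Proof.
case: tv_creation => /bij_inj v_inj _ _.
by rewrite rev_uniq map_inj_uniq ?enum_uniq.
Qed.

Lemma vertices_full x : x \in vs.
Proof.
case: tv_creation => -[w _ wK] _ _.
by rewrite mem_rev -[x]wK map_f // mem_enum.
Qed.

Lemma creation_sequence_list : creation_list e ts vs.
Proof.
have n_gt0 := threshold_graph_gt0; have [_ _ adj] := tv_creation.
apply: (@creation_list_rev _ _ (v (Ordinal n_gt0))).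
  by rewrite size_map size_enum_ord size_tuple.
move=> i j; rewrite size_tuple => /andP[ltji ltin].
have vE (k : 'I_n) :
    nth (v (Ordinal n_gt0)) [seq v i | i <- enum 'I_n] k = v k.
  by rewrite (nth_map k) ?size_enum_ord // nth_ord_enum.
rewrite (vE (Ordinal ltin)) (vE (Ordinal (ltn_trans ltji ltin))).
have := adj (Ordinal ltin) (leq_ltn_trans (leq0n j) ltji).
rewrite (tnth_nth true) /=.
by case: (nth true t i) => [|/(_ _ _)/negbTE] ->.
Qed.

Lemma encoded_bits : stored M 0 (map nat_of_bool ts).
Proof.
rewrite map_rev; apply: stored_rev => i; rewrite size_map size_tuple => lti.
by rewrite /M /= nth_cat size_map size_tuple lti.
Qed.

Lemma encoded_names : stored M n (map (@vertex_name T) vs).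
Proof.
rewrite map_rev -map_comp; apply: stored_rev => i _.
by rewrite addnS /M /= nth_cat size_map size_tuple ltnNge leq_addr addKn.
Qed.

(** Cells beyond the input read as the default 0, so the counter starts cleared. *)
Lemma encoded_zeros : stored M (n + n) (nseq n 0).
Proof.
rewrite -[nseq n 0]revK rev_nseq; apply: stored_rev => i _.
rewrite nth_nseq if_same addnS /M /= nth_default //.
by rewrite size_cat !size_map -enumT size_enum_ord size_tuple leq_addr.
Qed.

End Encoding.

Theorem theorem3p33 :
  (exists (P : program) (c : nat),
     forall (n : nat) (T : finType) (e : rel T) (t : n.-tuple bool)
            (v : 'I_n -> T),
       simple_graph e -> #|T| = n -> threshold_graph e ->
       creation_sequence e t v ->
       outputs_within P (encode_creation t v) (c * n)
         [:: #|independent_sets e|])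
  /\
  (exists (P : program) (c : nat),
     forall (n : nat) (T : finType) (e : rel T) (t : n.-tuple bool)
            (v : 'I_n -> T),
       simple_graph e -> #|T| = n -> threshold_graph e ->
       creation_sequence e t v ->
       exists L : seq (seq T),
         lists_independent_sets e L /\
         outputs_within P (encode_creation t v) (c * (n * 2 ^ (n - 1)))
           (encode_sets L)).
Proof.
split.
  (* As [n] is positive, [7 * n + 5 <= 12 * n]. *)
  exists count_program, 12 => n T e t v e_simple cardT e_thr tv.
  have n_gt0 := threshold_graph_gt0 e_thr cardT.
  have size_ts : size (rev t) = n by rewrite size_rev size_tuple.
  rewrite (card_independent_sets e_simple (creation_sequence_list e_thr cardT tv)
             (vertices_uniq tv) (vertices_full tv)).
  apply/outputs_withinP/(@reaches_leq _ (7 * size (rev t) + 5)); first lia.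
  apply: count_programP; first by rewrite size_ts.
  exact: encoded_bits.
(* With [p = 2 ^ (n - 1)], the time [2 * p * (24 * n + 13) + 3] is at most
   [(48 + 26 + 3) * (n * p)]. *)
exists enum_program, 77 => n T e t v e_simple cardT e_thr tv.
have n_gt0 := threshold_graph_gt0 e_thr cardT.
set vs := rev [seq v i | i <- enum 'I_n].
have size_vs : size (map (@vertex_name T) vs) = n.
  by rewrite size_map size_rev size_map size_enum_ord.
exists (selected_masks (rev t) vs 1 (2 ^ size vs).-1); split.
  exact: (selected_masks_independent e_simple
    (creation_sequence_list e_thr cardT tv) (vertices_uniq tv)
    (vertices_full tv)).
apply: outputs_withinP; rewrite /encode_sets.
rewrite (map_comp (fun s => rcons s 0) (map (@vertex_name T))).
rewrite -selected_masks_map -(size_map (@vertex_name T) vs).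
apply: reaches_leq (enum_programP _ _ _ _ _); rewrite ?size_vs.
- rewrite -{1}(prednK n_gt0) expnS subn1.
  have : 0 < 2 ^ n.-1 by rewrite expn_gt0.
  by move: (2 ^ n.-1) => p p_gt0; nia.
- by rewrite size_rev size_tuple.
- by [].
- exact: encoded_bits.
- exact: encoded_names.
- exact: encoded_zeros.
Qed.
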